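(* Let $p$ be a prime. The following is a complete list, up to isomorphism, of left braces $G$ of order $p$ and $p^2$ (that is: each item defines a left brace with the indicated additive group and the indicated multiplicative group $(G,\cdot)$ up to isomorphism, and every left brace of order $p$ or $p^2$ is isomorphic to exactly one of them). Additive group isomorphic to $\mathbb{Z}/(p)$: - (i) $x_1\cdot x_2=x_1+x_2$; then $(G,\cdot)\cong\mathbb{Z}/(p)$. Additive group isomorphic to $\mathbb{Z}/(p^2)$: - (ii) $x_1\cdot x_2=x_1+x_2$; then $(G,\cdot)\cong\mathbb{Z}/(p^2)$. - (iii) $x_1\cdot x_2=x_1+x_2+px_1x_2$; then $(G,\cdot)\cong\mathbb{Z}/(2)\times\mathbb{Z}/(2)$ if $p=2$, and $(G,\cdot)\cong\mathbb{Z}/(p^2)$ if $p\neq2$. Additive group isomorphic to $\mathbb{Z}/(p)\times\mathbb{Z}/(p)$: - (iv) $(x_1,y_1)\cdot(x_2,y_2)=(x_1+x_2,\;y_1+y_2)$; then $(G,\cdot)\cong\mathbb{Z}/(p)\times\mathbb{Z}/(p)$. - (v) $(x_1,y_1)\cdot(x_2,y_2)=(x_1+x_2+y_1y_2,\;y_1+y_2)$; then $(G,\cdot)\cong\mathbb{Z}/(4)$ if $p=2$, and $(G,\cdot)\cong\mathbb{Z}/(p)\times\mathbb{Z}/(p)$ if $p\neq2$.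
   Context: A left brace is a set $B$ with two operations $+$ and $\cdot$ such that $(B,+)$ is an abelian group, $(B,\cdot)$ is a group, and $a\cdot(b+c)+a=a\cdot b+a\cdot c$ for all $a,b,c\in B$. A morphism of left braces is a map preserving both operations. A dot denotes the brace multiplication; juxtaposition denotes ordinary ring multiplication in $\mathbb{Z}/(p)$ or $\mathbb{Z}/(p^2)$. The additive structure of each brace is the usual addition of the indicated group. *)

(* Defs.v *)
From HB Require Import structures.
From mathcomp Require Import all_boot all_order all_fingroup all_algebra.

Set Implicit Arguments.
Unset Strict Implicit.
Unset Printing Implicit Defensive.

Import GRing.Theory.

Local Open Scope ring_scope.

Definition is_group (T : Type) (mul : T -> T -> T) : Prop :=
  exists (e : T) (inv : T -> T),
    [/\ associative mul, left_id e mul, right_id e mul,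
        left_inverse e inv mul & right_inverse e inv mul].

Record is_left_brace (B : zmodType) (mul : B -> B -> B) : Prop := IsLeftBrace {
  brace_is_group : is_group mul;
  braceD : forall a b c, mul a (b + c) + a = mul a b + mul a c
}.

Definition is_brace_morphism (B1 B2 : zmodType) (mul1 : B1 -> B1 -> B1)
    (mul2 : B2 -> B2 -> B2) (f : B1 -> B2) : Prop :=
  {morph f : x y / x + y} /\ {morph f : x y / mul1 x y >-> mul2 x y}.

Definition brace_isom (B1 B2 : zmodType) (mul1 : B1 -> B1 -> B1)
    (mul2 : B2 -> B2 -> B2) : Prop :=
  exists f : B1 -> B2, is_brace_morphism mul1 mul2 f /\ bijective f.

(* The carrier of a finite left brace, with its multiplicative group as the
   canonical group structure (hiding the one that MathComp derives from +). *)
Definition mulgroup (B : finZmodType) (mul : B -> B -> B)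
  (HB : is_left_brace mul) : Type := B.

Section MulGroup.
Variables (B : finZmodType) (mul : B -> B -> B) (HB : is_left_brace mul).

Let inv (x : B) : B := odflt 0 [pick y | mul y x == 0].

Lemma brace_mulA : associative mul.
Proof. by case: HB => [[e [i []]]]. Qed.

(* a . (0 + 0) + a = a . 0 + a . 0 forces a . 0 = a, so the multiplicative
   identity of a left brace is 0. *)
Lemma brace_mul0 : left_id 0 mul.
Proof.
case: HB => [[e [i [_ mul1 _ _ _]]] mulD] x.
have /addrI e0 : mul e 0 + e = mul e 0 + mul e 0 by rewrite -mulD addr0.
by rewrite -[X in mul X _](mul1 0) -e0 mul1.
Qed.

Lemma brace_mulV : left_inverse 0 inv mul.
Proof.
move=> x; rewrite /inv; case: pickP => [y /eqP //|no].
case: HB => [[e [i [_ mul1 mulr1 mulV _]]] _].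
have e0 : e = 0 by rewrite -(mulr1 0) brace_mul0.
by have := no (i x); rewrite mulV e0 eqxx.
Qed.

HB.instance Definition _ := Finite.copy (mulgroup HB) B.
HB.instance Definition _ :=
  Finite_isGroup.Build (mulgroup HB) brace_mulA brace_mul0 brace_mulV.

End MulGroup.

(* Registers that a product of finite abelian groups is one. *)
HB.instance Definition _ (A B : finZmodType) := GRing.Zmodule.on (A * B)%type.

Variant brace_item :=
  | Zp_trivial | Zp2_trivial | Zp2_twisted | ZpZp_trivial | ZpZp_twisted.

Definition item_carrier (p : nat) (i : brace_item) : finZmodType :=
  match i with
  | Zp_trivial => 'Z_p
  | Zp2_trivial | Zp2_twisted => 'Z_(p ^ 2)
  | ZpZp_trivial | ZpZp_twisted => ('Z_p * 'Z_p)%type : finZmodType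
  end.

Definition item_mul (p : nat) (i : brace_item) :
    item_carrier p i -> item_carrier p i -> item_carrier p i :=
  match i return item_carrier p i -> item_carrier p i -> item_carrier p i with
  | Zp_trivial => fun x1 x2 : 'Z_p => x1 + x2
  | Zp2_trivial => fun x1 x2 : 'Z_(p ^ 2) => x1 + x2
  | Zp2_twisted => fun x1 x2 : 'Z_(p ^ 2) => x1 + x2 + p%:R * x1 * x2
  | ZpZp_trivial => fun a b : 'Z_p * 'Z_p => (a.1 + b.1, a.2 + b.2)
  | ZpZp_twisted => fun a b : 'Z_p * 'Z_p =>
      (a.1 + b.1 + a.2 * b.2, a.2 + b.2)
  end.

(* Main.v *)
(* In a left brace write a . b = a + lam_a b; then a |-> lam_a is an action of
   the multiplicative group on the additive group.  Let #|B| = p^n with n > 0.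
   The multiplicative group is a p-group, so it fixes some e <> 0 with p e = 0.
   If n = 1, e generates B and the action is trivial.  If n = 2, pick g outside
   <e>; modulo <e> every lam_a multiplies g by some c with c^(p^2) = 1 mod p,
   so c = 1 by Fermat and lam_a g = g + v(a) e.  The map v is a morphism from
   the multiplicative group to Z/p.  If v(e) <> 0, some y satisfies
   e . (y g) = y g, which is absurd; hence v(x e + y g) = y v(g), and
     (x e + y g) . (x' e + y' g) = (x + x' + v(g) y y') e + (y + y') g.
   Rescaling e (if p g = 0) or g (if p g <> 0) turns v(g) into 0 or 1.
   The order, whether p kills the additive group, and whether the two
   operations agree distinguish the five braces.
   For odd p and h = 1/2, the logarithms x - p h x^2 and (x - h y^2, y)
   linearise the two twisted multiplications. *)
Require Import Defs.
From HB Require Import structures.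
From mathcomp Require Import all_boot all_order all_fingroup all_algebra.
From mathcomp Require Import all_solvable ring zify.

Set Implicit Arguments.
Unset Strict Implicit.
Unset Printing Implicit Defensive.

Import GRing.Theory.
Local Open Scope ring_scope.

(** * The five multiplications define left braces *)

Lemma left_brace_add (B : zmodType) : is_left_brace (fun x y : B => x + y).
Proof.
split; last by move=> a b c; rewrite addrAC -addrA addrACA addrA.
exists 0, -%R; split.
- exact: addrA.
- exact: add0r.
- exact: addr0.
- exact: addNr.
- exact: addrN.
Qed.

Lemma left_brace_nil (R : comNzRingType) (q : R) :
  q * q = 0 -> is_left_brace (fun x y : R => x + y + q * x * y).
Proof.
move=> q0; split; last by move=> a b c; ring.
(* This is $-x/(1+qx)$ expanded to first order in $q$; multiplying it by $x$ leaves the defect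
   $q^2x^3$, which [q0] kills. *)
exists 0, (fun x => - x + q * x * x); split=> [x y z|x|x|x|x]; try ring.
- by rewrite [LHS](_ : _ = q * q * (x * x * x)); [rewrite q0 mul0r|ring].
- by rewrite [LHS](_ : _ = q * q * (x * x * x)); [rewrite q0 mul0r|ring].
Qed.

Lemma left_brace_heis (R : comNzRingType) :
  is_left_brace
    (fun a b : R * R => (a.1 + b.1 + a.2 * b.2, a.2 + b.2) : R * R).
Proof.
split.
  exists 0, (fun a => (- a.1 + a.2 * a.2, - a.2)).
  by split=> [[x y] [z t] [u v]|[x y]|[x y]|[x y]|[x y]];
    congr pair => /=; ring.
by move=> [x y] [z t] [u v]; congr pair => /=; ring.
Qed.

Lemma natr_sqr_Zp (p : nat) : prime p -> p%:R * p%:R = 0 :> 'Z_(p ^ 2).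
Proof.
move=> p_pr; rewrite -natrM mulnn -[RHS](@pchar_Zp (p ^ 2)) //.
by rewrite (ltn_exp2l 0) ?prime_gt1.
Qed.

Lemma item_left_brace (p : nat) (i : brace_item) :
  prime p -> is_left_brace (@item_mul p i).
Proof.
move=> p_pr; case: i; try exact: left_brace_add.
- exact: left_brace_nil (natr_sqr_Zp p_pr).
- exact: left_brace_heis.
Qed.

(** * Multiplicative groups of the five items *)

Lemma mulgroup_isog (B : finZmodType) (mul : B -> B -> B)
    (HB : is_left_brace mul) (gT : finGroupType) (f : B -> gT) :
  {morph f : x y / mul x y >-> (x * y)%g} -> injective f -> #|B| = #|gT| ->
  [set: mulgroup HB] \isog [set: gT].
Proof.
move=> fM f_inj cardB.
have f'M : {in [set: mulgroup HB] &,
    {morph (f : mulgroup HB -> gT) : x y / (x * y)%g}}.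
  by move=> x y _ _; apply: fM.
apply/isogP; exists (Morphism f'M); first by apply/injmP=> x y _ _ /f_inj.
apply/eqP; rewrite eqEcard subsetT morphimEdom card_imset; last exact: f_inj.
by rewrite !cardsT -cardB leqnn.
Qed.

Lemma Zp_half (n : nat) : odd n -> (1 < n)%N -> exists h : 'Z_n, h + h = 1.
Proof.
(* For odd $n$, [uphalf n] is $(n+1)/2$, whose double is $n+1$. *)
move=> n_odd n_gt1; exists (uphalf n)%:R.
rewrite -natrD addnn -[RHS](addr0 1) -(pchar_Zp n_gt1) nat1r.
by congr _%:R; lia.
Qed.

Section Items.
Variables (p : nat) (p_pr : prime p).
Variable (HB : forall i, is_left_brace (@item_mul p i)).

Lemma Zp2_twisted_odd_isog :
  p <> 2 -> [set: mulgroup (HB Zp2_twisted)] \isog [set: 'Z_(p ^ 2)].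
Proof.
move=> p_n2; have [//|p_odd] := even_prime p_pr.
have [h h2] : exists h : 'Z_(p ^ 2), h + h = 1.
  by apply: Zp_half; rewrite ?oddX ?p_odd // (ltn_exp2l 0) ?prime_gt1.
have p0 := natr_sqr_Zp p_pr; set q : 'Z_(p ^ 2) := p%:R in p0.
pose f (x : 'Z_(p ^ 2)) := x - q * h * x * x.
apply: (@mulgroup_isog _ _ _ _ f) => //.
  move=> x y /=; rewrite /f -/q.
  (* Besides the wanted terms, only a multiple of $1-2h$ and a multiple of $q^2$ remain, and both
     vanish. *)
  transitivity (x + y + q * x * y * (1 - (h + h)) - q * h * x * x
    - q * h * y * y
    - q * q * (2 * h * (x + y) * x * y + q * h * x * x * y * y)).
    by ring.
  by rewrite h2 p0 {1}/mulg /=; ring.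
(* Changing the sign of the quadratic term inverts [f] modulo $q^2$. *)
apply: (can_inj (g := fun y => y + q * h * y * y)) => x; rewrite /f.
transitivity
  (x + q * q * (- 2 * h * h * x * x * x + q * h * h * h * x * x * x * x)).
  by ring.
by rewrite p0 mul0r addr0.
Qed.

Lemma ZpZp_twisted_odd_isog :
  p <> 2 -> [set: mulgroup (HB ZpZp_twisted)] \isog [set: ('Z_p * 'Z_p)%type].
Proof.
move=> p_n2; have [//|p_odd] := even_prime p_pr.
have [h h2] : exists h : 'Z_p, h + h = 1 by apply: Zp_half (prime_gt1 p_pr).
pose f (a : 'Z_p * 'Z_p) := (a.1 - h * a.2 * a.2, a.2).
apply: (@mulgroup_isog _ _ _ _ f) => //.
  move=> [x y] [z t] /=; congr pair => /=.
  transitivity (x + z + y * t * (1 - (h + h)) - h * y * y - h * t * t).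
    by ring.
  by rewrite h2 {1}/mulg /=; ring.
move=> [x y] [z t] eq_f; have yt : y = t := congr1 snd eq_f.
by have := congr1 fst eq_f; rewrite /f /= yt => /addIr ->.
Qed.

End Items.

Lemma Zp2_twisted_2_isog (HB : is_left_brace (@item_mul 2 Zp2_twisted)) :
  [set: mulgroup HB] \isog [set: ('Z_2 * 'Z_2)%type].
Proof.
(* The low and high binary digits of $x$. In $x+y+2xy$ the last term cancels the carry between the
   low digits, so digits add independently. *)
pose f (x : 'Z_4) : 'Z_2 * 'Z_2 := (x%:R, (2 <= x)%N%:R).
apply: (@mulgroup_isog _ _ _ _ f).
- by move=> [[|[|[|[|//]]]] ?] [[|[|[|[|//]]]] ?]; congr pair; apply/val_inj.
- by move=> [[|[|[|[|//]]]] ?] [[|[|[|[|//]]]] ?] // _; apply/val_inj.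
- by rewrite card_prod !card_ord.
Qed.

Lemma ZpZp_twisted_2_isog (HB : is_left_brace (@item_mul 2 ZpZp_twisted)) :
  [set: mulgroup HB] \isog [set: 'Z_4].
Proof.
(* Here [a.1] is the high binary digit and [a.2] the low one: the product of the low digits in the
   twisted law is exactly the carry of addition modulo 4. *)
pose f (a : 'Z_2 * 'Z_2) : 'Z_4 := (a.1 * 2 + a.2)%N%:R.
apply: (@mulgroup_isog _ _ _ _ f).
- move=> [[[|[|//]] ?] [[|[|//]] ?]] [[[|[|//]] ?] [[|[|//]] ?]];
    by apply/val_inj; vm_compute.
- by move=> [[[|[|//]] ?] [[|[|//]] ?]] [[[|[|//]] ?] [[|[|//]] ?]] // _;
    congr pair; apply/val_inj.
- by rewrite card_prod !card_ord.
Qed.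

(** * Multiples and torsion in abelian groups *)

Lemma mulrn_card (B : finZmodType) (b : B) : b *+ #|B| = 0.
Proof. by have := expg_cardG (in_setT b); rewrite cardsT FinRing.zmodXgE. Qed.

(** Bezout with natural coefficients, the form suited to the multiples [b *+ n]: [u] inverts [x]
    modulo [m]. *)
Lemma coprime_inv (x m : nat) :
  coprime x m -> (1 < m)%N -> exists u v, (u * x = v * m + 1)%N.
Proof.
move=> xm m_gt1; have x_gt0 : (0 < x)%N.
  by case: x xm => //; rewrite /coprime gcd0n => /eqP m1; rewrite m1 in m_gt1.
by case: (egcdnP m x_gt0) => u v; rewrite (eqP xm) => uv _; exists u, v.
Qed.

Section Torsion.
Variables (V : zmodType) (p : nat) (p_pr : prime p).
Implicit Types e g : V.

Lemma mulrn_dvd e m x : e *+ m = 0 -> (m %| x)%N -> e *+ x = 0.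
Proof. by move=> em /dvdnP[k ->]; rewrite mulnC mulrnA em mul0rn. Qed.

Lemma mulrn_modn e m x : e *+ m = 0 -> e *+ (x %% m) = e *+ x.
Proof.
by move=> em; rewrite {2}(divn_eq x m) mulrnDr mulnC mulrnA em mul0rn add0r.
Qed.

Lemma mulrn_eq0 e x : e *+ p = 0 -> e != 0 -> (e *+ x == 0) = (p %| x)%N.
Proof.
move=> ep e0; apply/eqP/idP; last exact: mulrn_dvd.
move=> ex; apply: contraR e0 => pNx.
have [|u [v uv]] := @coprime_inv x p _ (prime_gt1 p_pr).
  by rewrite coprime_sym prime_coprime.
have : e *+ (u * x) = 0 by rewrite mulnC mulrnA ex mul0rn.
by rewrite uv mulrnDr mulnC mulrnA ep mul0rn add0r mulr1n => ->.
Qed.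

Lemma mulrn_eq e x y : e *+ p = 0 -> e != 0 ->
  (e *+ x == e *+ y) = (x == y %[mod p]).
Proof.
move=> ep e0; wlog le_yx : x y / (y <= x)%N.
  by move=> H; case/orP: (leq_total x y) => [/H|/H//]; rewrite eq_sym => ->.
by rewrite eqn_mod_dvd // -(mulrn_eq0 _ ep e0) mulrnBr // subr_eq0.
Qed.

(** The second hypothesis makes the order of [g] modulo the span of [e] a multiple of [p], so
    coefficients of [g] can be compared in that quotient. *)
Lemma mulrn2_eqr e g x y z t : e *+ p = 0 ->
  (forall m n, g *+ n = e *+ m -> (p %| n)%N) ->
  e *+ x + g *+ y = e *+ z + g *+ t -> y = t %[mod p].
Proof.
move=> ep gE; wlog le_ty : x y z t / (t <= y)%N.
  move=> H; case/orP: (leq_total t y) => [/H/[apply] //|ty].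
  by move/esym/(H _ _ _ _ ty).
(* The witness stands for $z-x$ without subtraction: $p-1$ acts as $-1$ on [e]. *)
move=> eq_c; apply/eqP; rewrite eqn_mod_dvd //; apply: (gE (z + x * p.-1)%N).
rewrite mulrnBr //; apply/eqP; rewrite subr_eq; apply/eqP.
apply: (addrI (e *+ x)); rewrite eq_c addrA -mulrnDr addnCA.
by rewrite -mulnS prednK ?prime_gt0 // mulrnDr mulnC mulrnA ep mul0rn addr0.
Qed.

Lemma mulrn2_eq e g (x y z t : 'I_p) : e *+ p = 0 -> e != 0 ->
  (forall m n, g *+ n = e *+ m -> (p %| n)%N) ->
  e *+ x + g *+ y = e *+ z + g *+ t -> (x, y) = (z, t).
Proof.
move=> ep e0 gE eq_c; have /eqP := mulrn2_eqr ep gE eq_c.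
rewrite !modn_small // => /eqP/val_inj yt; move: eq_c.
rewrite yt => /addIr/eqP; rewrite mulrn_eq // !modn_small // => /eqP.
by move/val_inj->.
Qed.

(** Since [g *+ p] is nonzero and killed by [p], the criterion for such elements applies twice,
    extracting one factor [p] each time. *)
Lemma mulrn_eq0_sqr g x : g *+ p != 0 -> g *+ (p ^ 2) = 0 ->
  g *+ x = 0 -> (p ^ 2 %| x)%N.
Proof.
rewrite -mulnn => gp gpp gx.
have /dvdnP[k xk] : (p %| x)%N.
  by rewrite -(@mulrn_eq0 (g *+ p)) // -mulrnA // mulnC mulrnA gx mul0rn.
rewrite xk dvdn_pmul2r ?prime_gt0 // -(@mulrn_eq0 (g *+ p)) -?mulrnA //.
by rewrite mulnC -xk gx.
Qed.

End Torsion.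

(** * The action [lam] and normal forms of braces of order $p$ and $p^2$ *)

Section Classification.
Variables (B : finZmodType) (mul : B -> B -> B) (HB : is_left_brace mul).
Variables (p : nat) (p_pr : prime p).

Let lam (a b : B) := mul a b - a.

Let mulE a b : mul a b = a + lam a b. Proof. by rewrite /lam addrC subrK. Qed.

Let lamD a b c : lam a (b + c) = lam a b + lam a c.
Proof.
apply: (addrI (a + a)); rewrite addrAC -mulE [a + a + _]addrACA -!mulE.
exact: (braceD HB).
Qed.

Let lam0 a : lam a 0 = 0.
Proof. by apply: (addrI (lam a 0)); rewrite -lamD !addr0. Qed.

Let lamMn a b n : lam a (b *+ n) = lam a b *+ n.
Proof. by elim: n => [|n IH]; rewrite ?mulr0n ?lam0 // !mulrS lamD IH. Qed.

Let lamM a b c : lam (mul a b) c = lam a (lam b c).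
Proof.
apply: (addrI (mul a b)); rewrite -mulE -(brace_mulA HB).
by rewrite mulE (mulE b c) lamD addrA -mulE.
Qed.

Let lam1 b : lam 0 b = b.
Proof. by rewrite /lam (brace_mul0 HB) subr0. Qed.

Lemma brace_addI a b : mul a b = b -> a = 0.
Proof.
move=> ab; apply: (@mulIg (mulgroup HB) b).
by rewrite [LHS]ab; apply/esym/(brace_mul0 HB).
Qed.

Lemma brace_fixed (n : nat) : #|B| = (p ^ n.+1)%N ->
  exists2 e : B, e != 0 & forall a, mul a e = a + e.
Proof.
move=> cardB.
(* [lam] acts on the left while [to] must be a right action, hence the inverse. *)
pose to (b : B) (a : mulgroup HB) := lam (a^-1)%g b.
have to1 : to^~ 1%g =1 id by move=> b; rewrite /to invg1 lam1.
have toM b : act_morph to b.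
  by move=> x y; rewrite /to invMg lamM.
pose act := TotalAction to1 toM.
have pG : (p.-group [set: mulgroup HB])%g.
  by rewrite /pgroup cardsT [#|_|]cardB pnatX pnat_id.
have /(pgroup_fix_mod pG) : [acts [set: mulgroup HB], on setT | act].
  by apply/subsetP=> a _; rewrite !inE; apply/subsetP=> b _; rewrite !inE.
(* The number of fixed points is congruent to $|B|$, hence to 0, modulo $p$; since 0 is fixed, there
   are at least $p$ of them. *)
set F := 'Fix_(_ | _)(_)%g; rewrite cardsT cardB expnS modnMr => /esym/eqP pF.
have F0 : 0 \in F.
  by apply/setIP; split; [exact: in_setT|apply/afixP=> a _; apply: lam0].
have [e Fe e0] : exists2 e, e \in F & e != 0.
  have : (1 < #|F|)%N.
    rewrite (leq_trans (prime_gt1 p_pr)) // dvdn_leq //.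
    by apply/card_gt0P; exists 0.
  rewrite (cardsD1 0) F0 => /card_gt0P[e]; rewrite in_setD1 => /andP[e0 Fe].
  by exists e.
exists e => // a; rewrite mulE; congr (_ + _).
have /setIP[_ /afixP fix_e] := Fe.
have := fix_e (a : mulgroup HB)^-1%g (in_setT _).
by rewrite [LHS]/(to _ _) /to invgK.
Qed.

Lemma brace_socle (n : nat) : #|B| = (p ^ n.+1)%N ->
  exists e : B, [/\ e != 0, e *+ p = 0 & forall a, mul a e = a + e].
Proof.
move=> cardB; have [e e0 fix_e] := brace_fixed cardB.
have ex : exists m, e *+ (p ^ m) == 0.
  by exists n.+1; rewrite -cardB mulrn_card.
(* The last nonzero multiple of [e] by a power of [p] has order [p], and it stays fixed because each
   [lam a] is additive. *)
case: (ex_minnP ex) => -[|m] /eqP em min_m.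
  by rewrite -em mulr1n eqxx in e0.
exists (e *+ (p ^ m)); split.
- by apply/negP=> /min_m; rewrite ltnn.
- by rewrite -mulrnA mulnC -expnS.
- by move=> a; rewrite mulE lamMn /lam fix_e addrAC subrr add0r.
Qed.

Lemma brace_prime_form : #|B| = p ->
  exists2 e : B, e != 0 & forall x y, mul (e *+ x) (e *+ y) = e *+ (x + y).
Proof.
move=> cardB; have [|e [e0 ep fix_e]] := @brace_socle 0; first by rewrite expn1.
exists e => // x y.
by rewrite mulE lamMn /lam fix_e addrAC subrr add0r mulrnDr.
Qed.

(** The number [k] records the additive extension of $B/\langle e\rangle$ by $\langle e\rangle$, and
    [d] the twist of the multiplication; the classification only has to normalise these two. *)
Lemma brace_prime2_form : #|B| = (p ^ 2)%N ->
  exists e g : B, exists d k : nat,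
    [/\ e != 0, e *+ p = 0, g *+ p = e *+ k,
        forall x y, g *+ y = e *+ x -> (p %| y)%N &
        forall x y x' y', mul (e *+ x + g *+ y) (e *+ x' + g *+ y') =
          e *+ (x + x' + d * (y * y')) + g *+ (y + y')].
Proof.
move=> cardB; have [e [e0 ep fix_e]] := brace_socle cardB.
have p_gt1 := prime_gt1 p_pr; have p_gt0 := prime_gt0 p_pr.
have lam_e a x : lam a (e *+ x) = e *+ x.
  by rewrite lamMn /lam fix_e addrAC subrr add0r.
pose E := [set e *+ x | x : 'I_p].
have memE x : e *+ x \in E.
  rewrite -(mulrn_modn _ ep).
  by apply/imsetP; exists (Ordinal (ltn_pmod x p_gt0)).
have [g gNE] : exists g : B, g \notin E.
  apply/existsP; rewrite -negb_forall; apply/negP=> /forallP allE.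
  have : (#|B| <= p)%N.
    rewrite -[X in (_ <= X)%N]card_ord -cardsT.
    apply: leq_trans (leq_imset_card (fun x : 'I_p => e *+ x) 'I_p).
    by apply/subset_leq_card/subsetP=> x _; apply: allE.
  by rewrite cardB -mulnn leqNgt ltn_Pmull.
(* Otherwise [y] is invertible modulo $p^2$, which kills [B], so [g] itself would be a multiple of
   [e]. *)
have gE x y : g *+ y = e *+ x -> (p %| y)%N.
  move=> gy; apply: contraR gNE => pNy.
  have [||u [v uv]] := @coprime_inv y (p ^ 2).
  - by rewrite coprime_sym coprimeXl ?prime_coprime.
  - by rewrite (ltn_exp2l 0).
  have : g *+ (u * y) = e *+ (x * u) by rewrite mulnC mulrnA gy mulrnA.
  rewrite uv mulrnDr mulnC mulrnA -cardB mulrn_card mul0rn add0r mulr1n => ->.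
  exact: memE.
have coordP b : exists x y : 'I_p, b = e *+ x + g *+ y.
  pose coord (z : 'I_p * 'I_p) := e *+ z.1 + g *+ z.2.
  have [c cK Kc] : bijective coord.
    apply: inj_card_bij; last by rewrite cardB card_prod card_ord mulnn.
    by move=> [x y] [z t]; apply: mulrn2_eq.
  by exists (c b).1, (c b).2; rewrite -[LHS]Kc.
have [k gp] : exists k, g *+ p = e *+ k.
  have [x [y gp]] := coordP (g *+ p); exists x.
  (* Subtracting $yg$ puts $(p-y)g$ in the span of [e]; as $y<p$, divisibility leaves only $y=0$. *)
  have : (p %| p - y)%N.
    by apply: (gE x); rewrite mulrnBr 1?ltnW // gp addrK.
  case y0 : (y : nat) gp => [|r] gp; first by rewrite gp mulr0n addr0.
  move/dvdn_leq; rewrite subn_gt0 -y0 ltn_ord => /(_ isT).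
  by rewrite leqNgt y0 ltn_subrL p_gt0.
have iter_lam a n b :
    iter n (lam a) b = lam ((a : mulgroup HB) ^+ n)%g b.
  elim: n => [|n IH]; first by rewrite [RHS]lam1.
  by rewrite iterS IH -lamM expgS.
have /fin_all_exists[v lam_g] : forall a, exists n, lam a g = e *+ n + g.
  move=> a; have [x [c lag]] := coordP (lam a g).
  exists x; rewrite lag; congr (_ + _).
  have lag_n n : exists w, iter n (lam a) g = e *+ w + g *+ (c ^ n).
    elim: n => [|n [w IH]]; first by exists 0%N; rewrite mulr0n add0r.
    exists (w + x * c ^ n)%N; rewrite iterS IH lamD lam_e lamMn lag mulrnDl.
    by rewrite addrA -!mulrnA -mulrnDr -expnS.
  (* At exponent $p^2$, the order of the multiplicative group, the iterate is the identity; Fermat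
     is then used twice on $c^{p\cdot p}$. *)
  have [w] := lag_n (p ^ 2)%N; rewrite iter_lam -cardB.
  have -> : ((a : mulgroup HB) ^+ #|B|)%g = 0.
    by have := expg_cardG (in_setT (a : mulgroup HB)); rewrite cardsT.
  rewrite lam1 -[X in X = _]add0r -[X in X + _](mulr0n e).
  move=> /(mulrn2_eqr (y := 1) p_pr ep gE).
  rewrite cardB -mulnn expnM !fermat_little // !modn_small // => <-.
  by rewrite mulr1n.
have eM m n : m = n %[mod p] -> e *+ m = e *+ n.
  by move=> mn; apply/eqP; rewrite (mulrn_eq p_pr) // mn.
have vM a b : v (mul a b) = v a + v b %[mod p].
  apply/eqP; rewrite -(mulrn_eq p_pr _ _ ep e0) -(inj_eq (addIr g)).
  by rewrite -lam_g lamM lam_g lamD lam_e lam_g addrA -mulrnDr addnC.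
have v_e : (p %| v e)%N.
  apply: contraR e0 => pNv.
  have [|u [n un]] := @coprime_inv (v e) p _ p_gt1.
    by rewrite coprime_sym prime_coprime.
  (* With $u\,v(e)\equiv 1$, the multiplier $u(p-1)$ makes [lam e] subtract exactly one [e], which
     cancels the [e] added by the product. *)
  apply/eqP/(@brace_addI _ (g *+ (u * p.-1))).
  rewrite mulE lamMn lam_g mulrnDl addrA -mulrnA -mulrS.
  rewrite (mulrn_dvd ep) ?add0r // mulnA [(v e * u)%N]mulnC un.
  rewrite mulnDl mul1n -addnS prednK // dvdn_addl //.
  by rewrite mulnAC dvdn_mull.
have v_ex x : v (e *+ x) = 0 %[mod p].
  elim: x => [|x IH].
    apply/eqP; rewrite -(mulrn_eq p_pr _ _ ep e0) -(inj_eq (addIr g)).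
    by rewrite -lam_g lam1 mulr0n add0r.
  rewrite mulrSr -fix_e vM -modnDml IH modnDml add0n.
  by apply/eqP; rewrite mod0n.
have vDe a x : v (a + e *+ x) = v a %[mod p].
  have -> : a + e *+ x = mul a (e *+ x) by rewrite mulE lam_e.
  by rewrite vM -modnDmr v_ex modnDmr addn0.
have vE x y : v (e *+ x + g *+ y) = v g * y %[mod p].
  elim: y => [|y IH]; first by rewrite mulr0n addr0 v_ex muln0.
  rewrite mulrSr addrA; set b := _ + _ in IH *.
  (* Adding $v(b)e$ leaves [v] unchanged modulo [p] and turns the sum $b+g$ into the product of [b]
     and [g], on which [v] is additive. *)
  rewrite -(vDe _ (v b)).
  have -> : b + g + e *+ v b = mul b g by rewrite mulE lam_g addrAC addrA.
  by rewrite vM -modnDml IH modnDml mulnS addnC.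
exists e, g, (v g), k; split=> // x y x' y'.
set b := e *+ x + g *+ y.
have lam_b z : lam b (g *+ z) = e *+ (v g * (y * z)) + g *+ z.
  rewrite lamMn lam_g mulrnDl -mulrnA; congr (_ + _); apply: eM.
  by rewrite -modnMml vE modnMml mulnA.
rewrite mulE lamD lam_e lam_b /b [e *+ x' + _]addrA -mulrnDr addrACA.
by rewrite -!mulrnDr addnA.
Qed.

(** * Matching the normal forms with the listed items *)

Lemma brace_isom_Zp : #|B| = p -> brace_isom (@item_mul p Zp_trivial) mul.
Proof.
move=> cardB; have p_gt1 := prime_gt1 p_pr.
have [e e0 mul_e] := brace_prime_form cardB.
have ep : e *+ p = 0 by rewrite -cardB mulrn_card.
(* Residues act through their natural representatives; [ep] makes the choice of representative
   harmless. *)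
have f_nat n : e *+ (n%:R : 'Z_p) = e *+ n.
  by rewrite /= val_Zp_nat // mulrn_modn.
have ZD (x y : 'Z_p) : x + y = (x + y)%N%:R by rewrite natrD !natr_Zp.
have fD (x y : 'Z_p) : e *+ (x + y)%R = e *+ x + e *+ y.
  by rewrite ZD f_nat mulrnDr.
exists (fun x : 'Z_p => e *+ x); split.
  by split=> x y; rewrite ?mul_e ?mulrnDr; apply: fD.
apply: inj_card_bij; last by rewrite cardB card_ord Zp_cast.
move=> x y /eqP; rewrite (mulrn_eq p_pr) //.
rewrite !modn_small; try by rewrite -[X in (_ < X)%N](Zp_cast p_gt1).
by move/eqP/val_inj.
Qed.

(** If [p] divides [c], the twist $cp$ is zero modulo $p^2$. Otherwise replace [g] by $wg$ with
    $wc\equiv 1$ modulo $p$: the twist becomes $wcp\equiv p$. *)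
Lemma brace_isom_Zp2 (g : B) (c : nat) :
  #|B| = (p ^ 2)%N -> g *+ p != 0 ->
  (forall x y, mul (g *+ x) (g *+ y) = g *+ (x + y + c * p * (x * y))) ->
  exists2 i, i = Zp2_trivial \/ i = Zp2_twisted &
    brace_isom (@item_mul p i) mul.
Proof.
move=> cardB gp mul_g.
have gpp : g *+ (p ^ 2) = 0 by rewrite -cardB mulrn_card.
have p2_gt1 : (1 < p ^ 2)%N by rewrite (ltn_exp2l 0) ?prime_gt1.
have f_nat w n : g *+ (w * (n%:R : 'Z_(p ^ 2))) = g *+ (w * n).
  by rewrite mulnC !mulrnA /= val_Zp_nat // mulrn_modn // -!mulrnA mulnC.
have ZD (x y : 'Z_(p ^ 2)) : x + y = (x + y)%N%:R by rewrite natrD !natr_Zp.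
have fD w (x y : 'Z_(p ^ 2)) :
    g *+ (w * (x + y)%R) = g *+ (w * x) + g *+ (w * y).
  by rewrite ZD f_nat mulnDr mulrnDr.
have f_bij w : coprime w p ->
    bijective (fun x : 'Z_(p ^ 2) => g *+ (w * x)).
  move=> wp; apply: inj_card_bij; last by rewrite cardB card_ord Zp_cast.
  move=> x y eq_xy; have : g *+ (w * (x - y)%R) = 0.
    apply: (addrI (g *+ (w * y))).
    by rewrite -fD [(y + _)%R]addrC subrK addr0.
  move/(mulrn_eq0_sqr p_pr gp gpp).
  rewrite Gauss_dvdr; last by rewrite coprime_sym coprimeXr.
  rewrite /dvdn modn_small; last by rewrite -[X in (_ < X)%N](Zp_cast p2_gt1).
  by move/eqP=> xy0; apply/eqP; rewrite -subr_eq0; apply/eqP/val_inj.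
have [pc|pNc] := boolP (p %| c)%N.
  exists Zp2_trivial; [by left|exists (fun x : 'Z_(p ^ 2) => g *+ (1 * x))].
  split; last by apply: f_bij; rewrite coprime1n.
  split=> x y; first exact: fD.
  rewrite [LHS]fD mul_g !mul1n !mulrnDr -[LHS]addr0; congr (_ + _); apply/esym.
  by apply: mulrn_dvd gpp _; rewrite dvdn_mulr // -mulnn dvdn_mul.
have [|w [v wv]] := @coprime_inv c p _ (prime_gt1 p_pr).
  by rewrite coprime_sym prime_coprime.
exists Zp2_twisted; [by right|exists (fun x : 'Z_(p ^ 2) => g *+ (w * x))].
split; last first.
  apply: f_bij; rewrite coprime_sym prime_coprime //; apply/negP=> pw.
  have : (p %| w * c)%N by rewrite dvdn_mulr.
  by rewrite wv dvdn_addr ?dvdn_mull // Euclid_dvd1.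
split=> x y; first exact: fD.
have itemE (z t : 'Z_(p ^ 2)) :
    z + t + p%:R * z * t = (z + t + p * (z * t))%N%:R.
  by rewrite !natrD !natrM !natr_Zp mulrA.
rewrite [item_mul _ _]itemE f_nat mul_g.
have -> : (c * p * (w * x * (w * y)) =
    w * (p * (x * y)) + p ^ 2 * (w * v * (x * y)))%N.
  transitivity (w * c * (w * p * (x * y)))%N; first by ring.
  by rewrite wv; ring.
by rewrite !mulnDr addnA [in RHS]mulrnDr [in X in _ + X]mulrnA gpp mul0rn addr0.
Qed.

(** When [p] does not divide [d], the element $de$ replaces [e] and absorbs the coefficient [d]. *)
Lemma brace_isom_ZpZp (e g : B) (d : nat) :
  #|B| = (p ^ 2)%N -> e != 0 -> e *+ p = 0 -> g *+ p = 0 ->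
  (forall x y, g *+ y = e *+ x -> (p %| y)%N) ->
  (forall x y x' y', mul (e *+ x + g *+ y) (e *+ x' + g *+ y') =
     e *+ (x + x' + d * (y * y')) + g *+ (y + y')) ->
  exists2 i, i = ZpZp_trivial \/ i = ZpZp_twisted &
    brace_isom (@item_mul p i) mul.
Proof.
move=> cardB e0 ep gp gE mul_eg; have p_gt1 := prime_gt1 p_pr.
have b_nat (b : B) n : b *+ p = 0 -> b *+ (n%:R : 'Z_p) = b *+ n.
  by move=> bp; rewrite /= val_Zp_nat // mulrn_modn.
have ZD (x y : 'Z_p) : x + y = (x + y)%N%:R by rewrite natrD !natr_Zp.
have ltZ (x : 'Z_p) : (x < p)%N by rewrite -[X in (_ < X)%N](Zp_cast p_gt1).
have f_bij (e' : B) : e' *+ p = 0 -> e' != 0 ->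
    (forall x y, g *+ y = e' *+ x -> (p %| y)%N) ->
    bijective (fun a : 'Z_p * 'Z_p => e' *+ a.1 + g *+ a.2).
  move=> e'p e'0 e'E; apply: inj_card_bij; last first.
    by rewrite cardB card_prod card_ord Zp_cast ?mulnn.
  move=> [x y] [z t].
  move/(mulrn2_eq (x := Ordinal (ltZ x)) (y := Ordinal (ltZ y))
    (z := Ordinal (ltZ z)) (t := Ordinal (ltZ t)) p_pr e'p e'0 e'E).
  by move=> [xz yt]; congr pair; apply/val_inj.
have fD (e' : B) (a b : 'Z_p * 'Z_p) : e' *+ p = 0 ->
    e' *+ (a.1 + b.1)%R + g *+ (a.2 + b.2)%R =
    e' *+ a.1 + g *+ a.2 + (e' *+ b.1 + g *+ b.2).
  by move=> e'p; rewrite !ZD !b_nat // !mulrnDr addrACA.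
have [pd|pNd] := boolP (p %| d)%N.
  exists ZpZp_trivial; [by left|].
  exists (fun a : 'Z_p * 'Z_p => e *+ a.1 + g *+ a.2); split; last exact: f_bij.
  split=> a b; [exact: fD|rewrite [LHS]fD // mul_eg addrACA -!mulrnDr].
  by rewrite [in RHS]mulrnDr (mulrn_dvd ep (dvdn_mulr _ pd)) addr0.
have e'p : e *+ d *+ p = 0 by rewrite mulrnAC ep mul0rn.
exists ZpZp_twisted; [by right|].
exists (fun a : 'Z_p * 'Z_p => e *+ d *+ a.1 + g *+ a.2); split; last first.
  apply: f_bij => //; first by rewrite (mulrn_eq0 p_pr).
  by move=> x y; rewrite -mulrnA; apply: gE.
split=> a b; first exact: fD.
have itemE (x y z t : 'Z_p) : x + z + y * t = (x + z + y * t)%N%:R.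
  by rewrite !natrD natrM !natr_Zp.
have -> : item_mul a b =
    ((a.1 + b.1 + a.2 * b.2)%N%:R, (a.2 + b.2)%N%:R) :> 'Z_p * 'Z_p.
  by rewrite -itemE -ZD.
by rewrite !b_nat // -!mulrnA mul_eg !mulnDr.
Qed.

Lemma brace_classification : #|B| = p \/ #|B| = (p ^ 2)%N ->
  exists i, brace_isom (@item_mul p i) mul.
Proof.
case=> cardB; first by exists Zp_trivial; apply: brace_isom_Zp.
have [e [g [d [k [e0 ep gp gE mul_eg]]]]] := brace_prime2_form cardB.
have [pk|pNk] := boolP (p %| k)%N.
  have gp0 : g *+ p = 0 by rewrite gp; apply: mulrn_dvd pk.
  by have [i _] := brace_isom_ZpZp cardB e0 ep gp0 gE mul_eg; exists i.
have [|u [v uv]] := @coprime_inv k p _ (prime_gt1 p_pr).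
  by rewrite coprime_sym prime_coprime.
(* As $uk\equiv 1$ modulo $p$, $e=uke=upg$: so [g] generates [B], and the twist $d\,e$ becomes
   $(du)p\,g$. *)
have eE : e = g *+ (p * u).
  rewrite mulrnA gp -mulrnA mulnC uv mulrnDr mulnC mulrnA ep mul0rn add0r.
  by rewrite mulr1n.
have [||i _] := @brace_isom_Zp2 g (d * u) cardB; last by exists i.
  by rewrite gp (mulrn_eq0 p_pr).
move=> x y; have := mul_eg 0%N x 0%N y; rewrite mulr0n !add0r => ->.
rewrite eE -mulrnA -mulrnDr; congr (_ *+ _).
by rewrite !add0n; ring.
Qed.

End Classification.

(** * The five braces are pairwise non-isomorphic *)

Lemma brace_isom_item_inj (p : nat) (i j : brace_item) (B : finZmodType)
    (mul : B -> B -> B) : prime p ->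
  brace_isom (@item_mul p i) mul -> brace_isom (@item_mul p j) mul -> i = j.
Proof.
move=> p_pr; have p_gt1 := prime_gt1 p_pr.
have p2_gt1 : (1 < p ^ 2)%N by rewrite (ltn_exp2l 0).
have p_Zp : p%:R = 0 :> 'Z_p by apply: pchar_Zp.
have p_Zp2 : p%:R != 0 :> 'Z_(p ^ 2).
  rewrite -val_eqE /= val_Zp_nat // modn_small -?lt0n ?prime_gt0 //.
  by rewrite -mulnn ltn_Pmull ?prime_gt0.
pose inv (C : finZmodType) (m : C -> C -> C) : bool * bool * bool :=
  (#|C| == p, [forall x : C, x *+ p == 0],
   [forall x, forall y, m x y == x + y]).
have invP k : brace_isom (@item_mul p k) mul ->
    inv _ (@item_mul p k) = inv B mul.
  case=> f [[fD fM] f_bij].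
  have f0 : f 0 = 0 by apply: (addrI (f 0)); rewrite -fD !addr0.
  have f_inj := bij_inj f_bij; have [f' fK f'K] := f_bij.
  have fn x n : f (x *+ n) = f x *+ n.
    by elim: n => [|n IH]; rewrite ?mulr0n ?f0 // !mulrS fD IH.
  rewrite /inv (bij_eq_card f_bij); congr (_, _, _).
    apply/forallP/forallP => H x; last by rewrite -(inj_eq f_inj) fn f0.
    by rewrite -(f'K x) -fn (eqP (H _)) f0.
  apply/'forall_forallP/'forall_forallP => H x y.
    by rewrite -(f'K x) -(f'K y) -fM (eqP (H _ _)) fD.
  by rewrite -(inj_eq f_inj) fM (eqP (H _ _)) fD.
suff inv_inj : injective (fun k => inv _ (@item_mul p k)).
  by move=> /invP ii /invP ij; apply: inv_inj; rewrite ii ij.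
have triv (C : finZmodType) :
    [forall x : C, forall y, x + y == x + y] = true.
  by apply/forallP=> x; apply/forallP=> y.
(* Values of [inv] on the items; the five triples are distinct. *)
pose code k := match k with
  | Zp_trivial => (true, true, true)
  | Zp2_trivial => (false, false, true)
  | Zp2_twisted => (false, false, false)
  | ZpZp_trivial => (false, true, true)
  | ZpZp_twisted => (false, true, false)
  end.
have p2Np : (p ^ 2 == p)%N = false.
  by rewrite -mulnn -{3}(muln1 p) eqn_pmul2l ?prime_gt0 // gtn_eqF.
suff invE k : inv _ (@item_mul p k) = code k.
  by move=> k l; rewrite !invE; case: k; case: l.
have Zp_kill (x : 'Z_p) : x *+ p = 0 by rewrite -mulr_natr p_Zp mulr0.
have Zp2_kill : [forall x : 'Z_(p ^ 2), x *+ p == 0] = false.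
  by apply/negP=> /forallP/(_ 1); apply/negP.
have ZpZp_kill : [forall x : 'Z_p * 'Z_p, x *+ p == 0] = true.
  apply/forallP=> a; apply/eqP.
  have pairMn n : a *+ n = (a.1 *+ n, a.2 *+ n).
    by elim: n => // n IH; rewrite mulrS IH !mulrS.
  by rewrite pairMn !Zp_kill.
have card_Zp : #|'Z_p| = p by rewrite card_ord Zp_cast.
have card_Zp2 : #|'Z_(p ^ 2)| = (p ^ 2)%N by rewrite card_ord Zp_cast.
have card_ZpZp : #|{: 'Z_p * 'Z_p}| = (p ^ 2)%N.
  by rewrite card_prod card_Zp mulnn.
rewrite /inv; case: k; congr (_, _, _); rewrite ?card_Zp ?card_Zp2 ?card_ZpZp
  ?eqxx ?p2Np //; try exact: triv.
- by apply/forallP=> x; apply/eqP/Zp_kill.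
(* The brace product of 1 with itself is $1+1+p$, and $p\ne 0$ modulo $p^2$. *)
- apply/negP=> /'forall_forallP/(_ 1 1)/eqP eq11.
  by case/eqP: p_Zp2; apply: (addrI (1 + 1)); rewrite addr0 -{2}eq11 /= !mulr1.
(* The first coordinate of the product of $(0,1)$ with itself is 1, against 0 for the sum. *)
- apply/negP=> /'forall_forallP/(_ (0, 1) (0, 1))/eqP eq01.
  have one0 : 0 + 0 + 1 * 1 = 0 + 0 :> 'Z_p := congr1 fst eq01.
  have /eqP := oner_neq0 'Z_p; apply.
  by rewrite -[LHS]mulr1 -[LHS]add0r -{1}(addr0 0).
Qed.

Local Close Scope ring_scope.

Theorem proposition2p4 (p : nat) (p_prime : prime p) :
  (exists HB : forall i : brace_item, is_left_brace (@item_mul p i),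
    [/\ [set: mulgroup (HB Zp_trivial)] \isog [set: 'Z_p],
        [set: mulgroup (HB Zp2_trivial)] \isog [set: 'Z_(p ^ 2)],
        (p = 2 ->
           [set: mulgroup (HB Zp2_twisted)] \isog [set: ('Z_2 * 'Z_2)%type]) /\
        (p <> 2 ->
           [set: mulgroup (HB Zp2_twisted)] \isog [set: 'Z_(p ^ 2)]),
        [set: mulgroup (HB ZpZp_trivial)] \isog [set: ('Z_p * 'Z_p)%type] &
        (p = 2 ->
           [set: mulgroup (HB ZpZp_twisted)] \isog [set: 'Z_4]) /\
        (p <> 2 ->
           [set: mulgroup (HB ZpZp_twisted)] \isog
             [set: ('Z_p * 'Z_p)%type])]) /\
  (forall (B : finZmodType) (mul : B -> B -> B),
     is_left_brace mul -> #|B| = p \/ #|B| = (p ^ 2)%N ->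
     exists! i : brace_item, brace_isom (@item_mul p i) mul).
Proof.
have HB i := @item_left_brace p i p_prime.
have id_isog (C : finZmodType) (m : C -> C -> C) (HC : is_left_brace m) :
    m =2 +%R -> [set: mulgroup HC] \isog [set: C].
  by move=> mE; apply: (@mulgroup_isog _ _ _ _ id).
split.
  exists HB; split; try exact: id_isog.
  - split; last exact: Zp2_twisted_odd_isog.
    by move=> p2; move: HB; rewrite p2 => HB; apply: Zp2_twisted_2_isog.
  - split; last exact: ZpZp_twisted_odd_isog.
    by move=> p2; move: HB; rewrite p2 => HB; apply: ZpZp_twisted_2_isog.
move=> B mul HBm cardB.
have [i isom_i] := brace_classification HBm p_prime cardB.
by exists i; split=> // j; apply: brace_isom_item_inj.
Qed.
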